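(* Let $D$ be an open interval $(a,b)$ or the circle, let $f_1,\dots,f_n : D\to\mathbb{R}$ be a Chebyshev system on $D$, and let $\rho : D \to \mathbb{R}$ be a continuous function of constant sign. Let $f : D\to\mathbb{R}$ be a continuous function which is orthogonal to $f_1,\dots,f_n$ with the weight function $\rho$, i.e. $\int_D f(x)f_i(x)\rho(x)\,dx=0$ for $i=1,\dots,n$. If the function $f\rho$ is not identically zero on $D$, then $f$ has at least $n$ sign changes on $D$.
   Context: The circle is parametrized by $[0,2\pi]$ with endpoints identified (functions on it are $2\pi$-periodic), and $dx$ is the corresponding measure. A set of continuous functions $f_1,\dots,f_n : D\to\mathbb{R}$ is a Chebyshev system (of order $n$) on $D$ if for any real constants $c_1,\dots,c_n$, not all zero, the function $\sum_{j=1}^n c_jf_j(x)$ vanishes at no more than $n-1$ different points of $D$. (On the circle the order $n$ is necessarily odd.) A function is of constant sign if it is nonnegative everywhere or nonpositive everywhere, and not identically zero. Sign changes: for a continuous function $f$ on $D$, each connected component of the zero set of $f$ is a point or an interval. The function $f$ changes sign on such a component if in any neighborhood of this component there exist two points at which the values of $f$ have opposite (nonzero) signs. The number of sign changes (zeros) of $f$ is the number of connected components of the zero set on which $f$ changes sign. *)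

(* Defs.v *)
From mathcomp Require Import all_boot all_order all_algebra.
From mathcomp Require Import all_classical all_reals all_analysis.

Set Implicit Arguments.
Unset Strict Implicit.
Unset Printing Implicit Defensive.
Import Order.TTheory GRing.Theory Num.Theory.
Import numFieldNormedType.Exports.

Local Open Scope classical_set_scope.
Local Open Scope card_scope.
Local Open Scope ring_scope.

(* A function on a domain D is represented by a total function on the ambient
   space T of which only the values on D matter; the topology of D is the one
   induced by T. *)

Definition chebyshev_system (R : realType) (T : topologicalType) (D : set T)
    (n : nat) (fs : 'I_n -> T -> R) : Prop :=
  (forall j, {within D, continuous (fs j)}) /\
  forall c : 'I_n -> R, (exists j, c j != 0) ->
    [set x | D x /\ \sum_(j < n) c j * fs j x = 0] #<= `I_(n.-1).

Definition constant_sign (R : realType) (T : Type) (D : set T) (g : T -> R) :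
    Prop :=
  ((forall x, D x -> 0 <= g x) \/ (forall x, D x -> g x <= 0)) /\
  exists2 x, D x & g x != 0.

Definition zero_set (R : realType) (T : Type) (D : set T) (f : T -> R) :
    set T :=
  [set x | D x /\ f x = 0].

Definition zero_components (R : realType) (T : topologicalType) (D : set T)
    (f : T -> R) : set (set T) :=
  [set connected_component (zero_set D f) x | x in zero_set D f].

(* The neighborhoods of C in the space D are the sets containing D `&` U for
   some open U of T that contains C. *)
Definition changes_sign_on (R : realType) (T : topologicalType) (D : set T)
    (f : T -> R) (C : set T) : Prop :=
  forall U : set T, open U -> C `<=` U ->
    exists y z, [/\ (D `&` U) y, (D `&` U) z, f y < 0 & 0 < f z].

Definition sign_changes (R : realType) (T : topologicalType) (D : set T)
    (f : T -> R) : set (set T) :=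
  [set C | zero_components D f C /\ changes_sign_on D f C].

(* The endpoints may be infinite. *)
Definition open_interval (R : realType) (a b : \bar R) : set R :=
  [set x | (a < x%:E)%E /\ (x%:E < b)%E].

Definition circle_param (R : realType) (t : R) : R * R := (cos t, sin t).

(* As a subset of the plane, so that it carries the topology of the interval
   [0, 2 pi] with its endpoints identified. *)
Definition circle (R : realType) : set (R * R) :=
  [set circle_param t | t in `[0, 2 * pi]].

Definition orthogonal_wrt (R : realType) (E : set R) (w f g : R -> R) : Prop :=
  (@lebesgue_measure R).-integrable E (fun x => (f x * g x * w x)%:E) /\
  (\int[@lebesgue_measure R]_(x in E) (f x * g x * w x)%:E = 0)%E.

(* The measure on the circle is dt, for t in [0, 2 pi]. *)
Definition circle_orthogonal_wrt (R : realType) (w f g : R * R -> R) : Prop :=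
  orthogonal_wrt `[0, 2 * pi] (w \o @circle_param R) (f \o @circle_param R)
    (g \o @circle_param R).

(* Main.v *)
(* Suppose f has fewer than n sign changes. Then on any finite set of points of
   the interval the signs of f alternate fewer than n times along the order, so
   there are n - 1 points q at which prod (x - q) changes sign compatibly with f
   (the superfluous q being placed below the whole finite set). The determinant
   g(x) = det (f_i(q_1), ..., f_i(q_(n-1)), f_i(x)) has the sign pattern of
   prod (x - q): a collocation determinant times the Vandermonde determinant of
   the same points is a symmetric function which does not vanish, hence keeps
   its sign. So f g >= 0 on the finite set, and compactness of the unit sphere of
   coefficients gives one nonzero combination g with f g >= 0 on the whole
   interval. Orthogonality makes f g rho vanish almost everywhere, although g has
   finitely many zeros and f rho is nonzero on some interval.
   On the circle the same argument is run on the parameters in ]0, 2 pi[; the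
   sign changes found there lie on distinct components of the zero set in the
   circle, because the chord through two points separates the two arcs. *)
Require Import Defs.
From mathcomp Require Import all_boot all_order all_algebra.
From mathcomp Require Import all_classical all_reals all_analysis.
From mathcomp Require Import measurable_realfun fingroup perm ring lra.
Set Implicit Arguments.
Unset Strict Implicit.
Unset Printing Implicit Defensive.
Import Order.TTheory GRing.Theory Num.Theory.
Import numFieldNormedType.Exports.

Local Open Scope classical_set_scope.
Local Open Scope card_scope.
Local Open Scope ring_scope.

(** * Collocation and Vandermonde determinants *)

Definition colloc_mx {R : realType} {n : nat} (F : 'I_n -> R -> R)
    (q : 'I_n -> R) : 'M[R]_n := \matrix_(i, j) F i (q j).

(** Taken as the collocation matrix of the monomials, so that the effect of permuting the points is
    proved once for both factors of [symdet]. *)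
Definition vandermonde_mx {R : realType} {n : nat} (q : 'I_n -> R) : 'M[R]_n :=
  colloc_mx (fun i x => x ^+ i) q.

(* Permuting the points multiplies both determinants by the same sign. *)
Definition symdet {R : realType} {n : nat} (F : 'I_n -> R -> R)
    (q : 'I_n -> R) : R := \det (colloc_mx F q) * \det (vandermonde_mx q).

Lemma det_vandermonde_mx {R : realType} {n : nat} (q : 'I_n -> R) :
  \det (vandermonde_mx q) =
  \prod_(i < n) \prod_(j < n | (i < j)%N) (q j - q i).
Proof.
have -> : vandermonde_mx q = Vandermonde n (\row_j q j).
  by apply/matrixP => i j; rewrite !mxE.
rewrite det_Vandermonde; apply: eq_bigr => i _; apply: eq_bigr => j _.
by rewrite !mxE.
Qed.

Lemma det_vandermonde_mx_neq0 {R : realType} {n : nat} (q : 'I_n -> R) :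
  injective q -> \det (vandermonde_mx q) != 0.
Proof.
move=> qI; rewrite det_vandermonde_mx; apply/prodf_neq0 => i _.
apply/prodf_neq0 => j ij; rewrite subr_eq0 (inj_eq qI).
by apply: contraTneq ij => ->; rewrite ltnn.
Qed.

Lemma det_colloc_mx_perm {R : realType} {n : nat} (F : 'I_n -> R -> R)
    (q : 'I_n -> R) (s : 'S_n) :
  \det (colloc_mx F (q \o s)) = (-1) ^+ s * \det (colloc_mx F q).
Proof.
have -> : colloc_mx F (q \o s) = col_perm s (colloc_mx F q).
  by apply/matrixP => i j; rewrite !mxE.
by rewrite col_permE det_mulmx det_perm odd_permV mulrC.
Qed.

Lemma symdet_perm {R : realType} {n : nat} (F : 'I_n -> R -> R)
    (q : 'I_n -> R) (s : 'S_n) : symdet F (q \o s) = symdet F q.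
Proof.
by rewrite /symdet !det_colloc_mx_perm mulrACA -signr_addb addbb mul1r.
Qed.

(** The permutation sends [i] to the number of points of the tuple below [q i]. It serves to bring
    two tuples into the same order. *)
Lemma exists_rank_perm {R : realType} {n : nat} (q : 'I_n -> R) :
  injective q ->
  exists s : 'S_n, forall i j, (q i < q j) = (s i < s j)%N.
Proof.
move=> qI.
pose r i := #|[pred k | q k < q i]|.
have rlt i : (r i < n)%N.
  rewrite -[X in (_ < X)%N]card_ord; apply: proper_card.
  rewrite properE subset_predT /=; apply/subsetPn; exists i => //.
  by rewrite inE ltxx.
have rmono i j : q i < q j -> (r i < r j)%N.
  move=> ij; apply: proper_card; rewrite properE; apply/andP; split.
    by apply/fintype.subsetP => k; rewrite !inE => /lt_trans; apply.
  by apply/subsetPn; exists i; rewrite !inE ?ltxx.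
have rE i j : (q i < q j) = (r i < r j)%N.
  apply/idP/idP => [/rmono//|]; apply: contraTT; rewrite -leNgt -leqNgt.
  by rewrite le_eqVlt => /orP[/eqP/qI->//|/rmono/ltnW].
pose r' i := Ordinal (rlt i).
have r'I : injective r'.
  move=> i j /(congr1 val)/= ij; apply: qI; apply/eqP.
  by case: ltgtP => //; rewrite rE ij ltnn.
by exists (perm r'I) => i j; rewrite !permE rE.
Qed.

(** * Constancy of the sign of the symmetrized determinant *)

Lemma cts_det {R : realType} {n : nat} (A : R -> 'M[R]_n) (t : R) :
  (forall i j, {for t, continuous (fun u => A u i j)}) ->
  {for t, continuous (fun u => \det (A u))}.
Proof.
move=> cA; rewrite /prop_for /continuous_at /determinant.
apply: cvg_big => [|s _]; first exact: add_continuous.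
apply: cvgM; first exact: cvg_cst.
apply: cvg_big => [|i _]; first exact: mul_continuous.
exact: cA.
Qed.

Lemma IVT_sign {R : realType} (h : R -> R) (a b : R) :
  a <= b -> {in `[a, b], continuous h} -> {in `[a, b], forall t, h t != 0} ->
  0 < h a * h b.
Proof.
move=> ab hc h0.
have [ha hb] : h a != 0 /\ h b != 0.
  by split; apply: h0; rewrite in_itv/= lexx ab.
rewrite lt_neqAle eq_sym mulf_neq0//= leNgt; apply/negP => hab.
have [] := @IVT R h a b 0 ab.
- apply: continuous_in_subspaceT => x; rewrite mem_setE => xab; exact: hc.
- rewrite ge_min le_max; have [h1|h1] : 0 < h a \/ h a < 0.
  + by apply/orP; rewrite orbC -neq_lt.
  + by rewrite (ltW h1) (ltW (_ : h b < 0)) ?orbT// -(pmulr_rlt0 _ h1).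
  + by rewrite (ltW h1) (ltW (_ : 0 < h b)) ?orbT// -(nmulr_rlt0 _ h1).
by move=> c /h0/eqP.
Qed.

(* Two injective tuples with the same order type are joined, after a
   permutation, by the straight segment between them, which stays injective. *)
Lemma symdet_sign {R : realType} {n : nat} (I : set R) (F : 'I_n -> R -> R)
    (p q : 'I_n -> R) :
  is_interval I -> (forall i x, I x -> {for x, continuous (F i)}) ->
  (forall r, injective r -> (forall j, I (r j)) -> \det (colloc_mx F r) != 0) ->
  injective p -> (forall j, I (p j)) -> injective q -> (forall j, I (q j)) ->
  0 < symdet F p * symdet F q.
Proof.
move=> II Fc Fn pI pin qI qin.
have [r [uE rI rin <-]] : exists r : 'I_n -> R,
    [/\ forall i j, (r i < r j) = (p i < p j), injective r,
       forall j, I (r j) & symdet F r = symdet F q].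
  have [s sP] := exists_rank_perm pI; have [s' s'P] := exists_rank_perm qI.
  (* [s] acts first: index [i] receives the point of [q] whose rank is that of [p i]. *)
  exists (q \o (s * s'^-1)%g); split; last exact: symdet_perm.
  - by move=> i j /=; rewrite s'P sP !permM !permKV.
  - exact: inj_comp qI perm_inj.
  - by move=> j; exact: qin.
pose L t j : R := (1 - t) * p j + t * r j.
have Lin t j : t \in `[0, 1] -> I (L t j).
  rewrite in_itv/= => /andP[t0 t1].
  have [pq|/ltW pq] := leP (p j) (r j).
    have h1 : 0 <= t * (r j - p j) by rewrite mulr_ge0 ?subr_ge0.
    have h2 : 0 <= (1 - t) * (r j - p j) by rewrite mulr_ge0 ?subr_ge0.
    by apply: (II (p j) (r j)) => //; rewrite /L; apply/andP; split; lra.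
  have h1 : 0 <= t * (p j - r j) by rewrite mulr_ge0 ?subr_ge0.
  have h2 : 0 <= (1 - t) * (p j - r j) by rewrite mulr_ge0 ?subr_ge0.
  by apply: (II (r j) (p j)) => //; rewrite /L; apply/andP; split; lra.
have Lmono t i j : t \in `[0, 1] -> p i < p j -> L t i < L t j.
  rewrite in_itv/= => /andP[t0 t1] pij; have := pij; rewrite -uE => rij.
  rewrite -subr_gt0 (_ : _ - _ = (1 - t) * (p j - p i) + t * (r j - r i)).
    move: t0; rewrite le_eqVlt => /predU1P[<-|t0].
      by rewrite subr0 mul1r mul0r addr0 subr_gt0.
    by rewrite ltr_wpDl ?mulr_gt0 ?mulr_ge0 ?subr_ge0 ?subr_gt0// ltW.
  by rewrite /L; ring.
have LI t : t \in `[0, 1] -> injective (L t).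
  move=> t01 i j Lij; case: (ltgtP (p i) (p j)) => [/(Lmono _ _ _ t01)|/(Lmono _ _ _ t01)|/pI//];
  by rewrite Lij ltxx.
have Lc j t : {for t, continuous (fun u => L u j)}.
  rewrite /prop_for /continuous_at /L.
  apply: cvgD; apply: cvgM; try exact: cvg_cst; try exact: cvg_id.
  by apply: cvgB; [exact: cvg_cst|exact: cvg_id].
have := @IVT_sign R (fun t => symdet F (L t)) 0 1 ler01.
have -> : symdet F (L 0) = symdet F p.
  by congr symdet; apply/funext => j; rewrite /L; lra.
have -> : symdet F (L 1) = symdet F r.
  by congr symdet; apply/funext => j; rewrite /L; lra.
apply.
- move=> t t01; rewrite /prop_for /continuous_at /symdet; apply: cvgM.
    apply: cts_det => i j.
    rewrite (_ : (fun u => _) = F i \o (fun u => L u j)); last first.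
      by apply/funext => v; rewrite /= mxE.
    apply: continuous_comp; first exact: Lc.
    by apply: Fc; exact: Lin.
  apply: cts_det => i j.
  rewrite (_ : (fun u => _) = (fun x => x ^+ i) \o (fun u => L u j)); last first.
    by apply/funext => v; rewrite /= mxE.
  apply: continuous_comp; first exact: Lc.
  exact: exprn_continuous.
- move=> t t01; rewrite /symdet mulf_neq0//.
    by apply: Fn => [|j]; [exact: LI|exact: Lin].
  by apply: det_vandermonde_mx_neq0; exact: LI.
Qed.

(** * Combinations with prescribed sign changes *)

(** The variable point stands last, so that it occupies only the last column of a collocation
    matrix. The default 0 is never reached when [Q] has size [m]. *)
Definition rcons_tuple {R : realType} {m : nat} (Q : seq R) (x : R) :
  'I_m.+1 -> R := fun j => nth 0 (rcons Q x) j.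

Lemma det_rcons_lincomb {R : realType} {m : nat} (F : 'I_m.+1 -> R -> R)
    (Q : seq R) : size Q = m ->
  exists c : 'I_m.+1 -> R, forall x,
    \det (colloc_mx F (rcons_tuple Q x)) = \sum_i c i * F i x.
Proof.
(* These cofactors omit the last column, so the last point 0 is an arbitrary choice. *)
move=> sQ; exists (fun i => cofactor (colloc_mx F (rcons_tuple Q 0)) i ord_max).
move=> x; rewrite (expand_det_col _ ord_max); apply: eq_bigr => i _.
rewrite mulrC !mxE /rcons_tuple nth_rcons sQ ltnn eqxx; congr (_ * _).
rewrite /cofactor; congr (_ * \det _); apply/matrixP => k l; rewrite !mxE.
by rewrite !nth_rcons sQ !lift_max ltn_ord.
Qed.

(** In the Vandermonde product the pairs containing the last index give the factors [x - q]; the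
    remaining pairs form the constant [v]. *)
Lemma det_vandermonde_rcons {R : realType} {m : nat} (Q : seq R) : size Q = m ->
  exists v, forall x, \det (vandermonde_mx (@rcons_tuple R m Q x)) =
                      v * \prod_(q <- Q) (x - q).
Proof.
move=> sQ; exists (\prod_(i < m) \prod_(j < m | (i < j)%N) (nth 0 Q j - nth 0 Q i)).
move=> x; rewrite det_vandermonde_mx big_ord_recr /= [X in _ * X]big_pred0; last first.
  by move=> j; rewrite ltnNge -ltnS ltn_ord.
rewrite mulr1 (big_nth 0) big_mkord sQ -big_split /=; apply: eq_bigr => i _.
rewrite big_mkcond big_ord_recr /= ltn_ord -big_mkcond /= /rcons_tuple.
rewrite !nth_rcons sQ /= ltnn eqxx !ltn_ord; congr (_ * _).
by apply: eq_bigr => j _; rewrite !nth_rcons sQ /= !ltn_ord.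
Qed.

Lemma rcons_tuple_inj {R : realType} {m : nat} (Q : seq R) (x : R) :
  size Q = m -> uniq Q -> x \notin Q -> injective (@rcons_tuple R m Q x).
Proof.
move=> sQ uQ xQ i j /eqP.
rewrite nth_uniq ?size_rcons ?sQ ?ltn_ord// ?rcons_uniq ?xQ//.
by move/eqP/val_inj.
Qed.

Lemma rcons_tuple_in {R : realType} {m : nat} (I : set R) (Q : seq R) (x : R) :
  size Q = m -> {in Q, forall q, I q} -> I x ->
  forall j, I (@rcons_tuple R m Q x j).
Proof.
move=> sQ QI Ix j; have : rcons_tuple Q x j \in rcons Q x.
  by rewrite mem_nth// size_rcons sQ.
by rewrite mem_rcons inE => /predU1P[->//|/QI].
Qed.

(** The values of [symdet] at [Q] followed by [x] and at [Q] followed by [y] have a positive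
    product, which is the stated quantity times [v ^+ 2]. Comparing two points expresses that the
    combination times the product keeps one sign off [Q], without naming that sign. *)
Lemma prescribed_sign_changes {R : realType} {m : nat} (I : set R)
    (F : 'I_m.+1 -> R -> R) (Q : seq R) :
  is_interval I -> (forall i x, I x -> {for x, continuous (F i)}) ->
  (forall r, injective r -> (forall j, I (r j)) -> \det (colloc_mx F r) != 0) ->
  size Q = m -> uniq Q -> {in Q, forall q, I q} ->
  exists c : 'I_m.+1 -> R, forall x y, I x -> I y -> x \notin Q -> y \notin Q ->
    0 < (\sum_i c i * F i x) * \prod_(q <- Q) (x - q) *
        ((\sum_i c i * F i y) * \prod_(q <- Q) (y - q)).
Proof.
move=> II Fc Fn sQ uQ QI.
have [c cE] := det_rcons_lincomb F sQ; have [v vE] := det_vandermonde_rcons sQ.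
exists c => x y Ix Iy xQ yQ.
have := symdet_sign II Fc Fn (rcons_tuple_inj sQ uQ xQ) (rcons_tuple_in sQ QI Ix)
  (rcons_tuple_inj sQ uQ yQ) (rcons_tuple_in sQ QI Iy).
rewrite /symdet !cE !vE.
set gx := \sum_i _; set gy := \sum_i _; set px := \prod_(q <- Q) _; set py := \prod_(q <- Q) _.
rewrite (_ : _ * _ = v ^+ 2 * (gx * px * (gy * py))); last by ring.
have [->|v0] := eqVneq v 0; first by rewrite expr0n mul0r ltxx.
by rewrite pmulr_rgt0// exprn_even_gt0.
Qed.

(** * Comparison with a combination on a finite set *)

(* l :: L is a greedy alternating subsequence; as all of Q lies above l, the
   product is positive at l, which fixes the global sign. *)
Lemma alternating_subseq {R : realType} (f : R -> R) (s : seq R) :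
  sorted <%R s ->
  {in s, forall p, f p = 0} \/
  exists l L Q, [/\ subseq (l :: L) s,
    path (fun x y => f x * f y < 0) l L,
    size Q = size L /\ uniq Q,
    {in Q, forall q, [/\ l < q, q \notin s & exists2 r, r \in s & q < r]} &
    f l != 0 /\ {in s, forall p, 0 <= f l * f p * \prod_(q <- Q) (q - p)}].
Proof.
elim: s => [|p s IH] /=; first by left.
rewrite path_sortedE; last exact: lt_trans.
move=> /andP[/allP ps ss].
have [fp|fp] := eqVneq (f p) 0.
  case: (IH ss) => [H|[l [L [Q [sub alt [sQ uQ] Qb [fl H]]]]]]; [left|right].
    by move=> x; rewrite inE => /predU1P[->//|/H].
  have lp : p < l by apply: ps; apply: (mem_subseq sub); rewrite mem_head.
  exists l, L, Q; split => //.
  - exact: subseq_trans sub (subseq_cons _ _).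
  - move=> q /Qb[lq qs [r rs qr]]; split => //.
      by rewrite inE negb_or qs andbT gt_eqF// (lt_trans lp).
    by exists r; rewrite ?inE ?rs ?orbT.
  - split => // x; rewrite inE => /predU1P[->|/H//].
    by rewrite fp mulr0 mul0r.
right; case: (IH ss) => [H|[l [L [Q [sub alt [sQ uQ] Qb [fl H]]]]]].
  exists p, [::], [::]; split => //=; first by rewrite eqxx sub0seq.
  split => // x; rewrite inE => /predU1P[->|/H ->]; rewrite big_nil mulr1.
    by rewrite -expr2 sqr_ge0.
  by rewrite mulr0.
have ls : l \in s by apply: (mem_subseq sub); rewrite mem_head.
have lp : p < l by exact: ps.
have Qp x : x <= l -> 0 < \prod_(q <- Q) (q - x).
  move=> xl; rewrite big_seq; apply: prodr_gt0 => q /Qb[lq _].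
  by rewrite subr_gt0 (le_lt_trans xl).
(* If [p] and [l] carry the same sign, the old [Q] still fits, since its product is positive at [p]
   as well. *)
have [flp|flp] : 0 < f l * f p \/ f l * f p < 0.
  by apply/orP; rewrite orbC -neq_lt mulf_neq0.
  exists l, L, Q; split => //.
  - exact: subseq_trans sub (subseq_cons _ _).
  - move=> q /Qb[lq qs [r rs qr]]; split => //.
      by rewrite inE negb_or qs andbT gt_eqF// (lt_trans lp).
    by exists r; rewrite ?inE ?rs ?orbT.
  - split => // x; rewrite inE => /predU1P[->|/H//].
    by rewrite mulr_ge0 ?(ltW flp)// ltW// Qp// ltW.
(* The signs at [p] and [l] are opposite: a new point is inserted midway between [p] and the next
   point of the list. *)
have [q pq qs] : exists2 q, p < q & {in s, forall r, q < r}.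
  case: s ss ps ls {IH sub Qb H} => // r s /= rs ps _.
  exists ((p + r) / 2); first by rewrite midf_lt// ps ?mem_head.
  move=> x; rewrite inE => /predU1P[->|xs].
    by rewrite midf_lt// ps ?mem_head.
  have : r < x by move: rs; rewrite path_sortedE; [move=> /andP[/allP /(_ _ xs)]|exact: lt_trans].
  by apply: lt_trans; rewrite midf_lt// ps ?mem_head.
exists p, (l :: L), (q :: Q); split => //=.
- by rewrite eqxx.
- by rewrite mulrC flp.
- split; first by rewrite sQ.
  rewrite uQ andbT; apply/negP => /Qb[lq _ _].
  by have := lt_trans lq (qs _ ls); rewrite ltxx.
- move=> x; rewrite inE => /predU1P[->|/Qb[lx xs [r rs xr]]].
    split => //; last by exists l; rewrite ?inE ?ls ?orbT// qs.
    by rewrite inE negb_or gt_eqF//=; apply/negP => /qs; rewrite ltxx.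
  split; [exact: lt_trans lx| |by exists r; rewrite ?inE ?rs ?orbT].
  by rewrite inE negb_or xs andbT gt_eqF// (lt_trans lp).
- split => // x; rewrite inE big_cons => /predU1P[->|xs].
    rewrite -expr2 mulr_ge0 ?sqr_ge0// mulr_ge0// ltW ?subr_gt0//.
    by rewrite Qp// ltW.
  have := H _ xs; have := qs _ xs; rewrite -subr_lt0 => qx h.
  (* The old inequality is multiplied by the two negative factors [f l * f p] and [q - x]; the
     square of [f l] is then cancelled. *)
  have : 0 <= (f l * f p) * (q - x) * (f l * f x * \prod_(q0 <- Q) (q0 - x)).
    by rewrite mulr_ge0// ltW// nmulr_rgt0.
  rewrite (_ : _ * _ = f l ^+ 2 * (f p * f x * ((q - x) * \prod_(q0 <- Q) (q0 - x)))); last by ring.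
  by rewrite pmulr_rge0// exprn_even_gt0.
Qed.

(** An open interval has room below each of its points; by induction on the list, a point below all
    of them is kept. *)
Lemma exists_below {R : realType} (I : set R) (x : R) (s : seq R) :
  is_interval I -> open I -> I x -> {in s, forall y, I y} ->
  exists e, [/\ I e, e < x & {in s, forall y, e < y}].
Proof.
move=> II Io Ix; elim: s => [_|y s IH sI].
  have /nbhs_ballP[d /= d0 dI] := open_nbhs_nbhs (conj Io Ix).
  exists (x - d / 2); split => //; last by rewrite gtrBl divr_gt0.
  by apply: dI; rewrite /ball/= opprB addrC subrK gtr0_norm ?divr_gt0// gtr_pMr// invf_lt1// ltr1n.
have [|e [Ie ex es]] := IH; first by move=> z zs; apply: sI; rewrite inE zs orbT.
have Iy : I y by apply: sI; rewrite mem_head.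
have [ey|ye] := ltP e y.
  by exists e; split => // z; rewrite inE => /predU1P[->|/es].
have /nbhs_ballP[d /= d0 dI] := open_nbhs_nbhs (conj Io Iy).
have dy : y - d / 2 < y by rewrite gtrBl divr_gt0.
exists (y - d / 2); split.
- by apply: dI; rewrite /ball/= opprB addrC subrK gtr0_norm ?divr_gt0// gtr_pMr// invf_lt1// ltr1n.
- exact: lt_trans (le_lt_trans ye ex).
- by move=> z; rewrite inE => /predU1P[->//|/es]; exact/lt_trans/lt_le_trans/ye.
Qed.

Lemma extend_below {R : realType} (I : set R) (x : R) (s Q : seq R) (k : nat) :
  is_interval I -> open I -> I x -> {in s, forall y, I y} ->
  {in Q, forall y, I y} -> uniq Q ->
  exists E, [/\ size E = k, uniq (E ++ Q), {in E ++ Q, forall y, I y} &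
               {in E, forall e, {in s, forall y, e < y}}].
Proof.
move=> II Io Ix sI QI uQ; elim: k => [|k [E [sE uE EI Es]]].
  by exists [::].
have [|e [Ie _ eE]] := @exists_below R I x (s ++ E ++ Q) II Io Ix.
  by move=> y; rewrite mem_cat => /orP[/sI|/EI].
exists (e :: E); split => /=.
- by rewrite sE.
- rewrite uE andbT; apply/negP => eEQ.
  by have := eE e; rewrite mem_cat eEQ orbT ltxx => /(_ isT).
- by move=> y; rewrite inE => /predU1P[->|/EI].
- move=> y; rewrite inE => /predU1P[->|/Es//] z zs.
  by apply: eE; rewrite mem_cat zs.
Qed.

(** [size L] counts the alternations along [l :: L]. As it is at most [m], the points [Q] separating
    the alternations can be completed to exactly [m] prescribed sign changes. *)
Lemma comparison_on_finite {R : realType} {m : nat} (I : set R)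
    (F : 'I_m.+1 -> R -> R) (f : R -> R) (s : seq R) :
  is_interval I -> open I ->
  (forall i x, I x -> {for x, continuous (F i)}) ->
  (forall r, injective r -> (forall j, I (r j)) -> \det (colloc_mx F r) != 0) ->
  (forall l L, {in l :: L, forall x, I x} -> path <%R l L ->
     path (fun x y => f x * f y < 0) l L -> (size L <= m)%N) ->
  sorted <%R s -> {in s, forall x, I x} ->
  exists2 c : 'I_m.+1 -> R, exists j, c j != 0 &
    {in s, forall p, 0 <= (\sum_i c i * F i p) * f p}.
Proof.
move=> II Io Fc Fn alt_le ss sI.
have [f0|[l [L [Q [sub alt [sQ uQ] Qb [fl H]]]]]] := alternating_subseq f ss.
  exists (fun=> 1); first by exists ord0; rewrite oner_neq0.
  by move=> p /f0 ->; rewrite mulr0.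
have subs := mem_subseq sub.
have ls : l \in s by apply: subs; rewrite mem_head.
have Il := sI _ ls.
have QI : {in Q, forall y, I y}.
  move=> q /Qb[lq _ [r rs qr]]; apply: (II l r) => //; first exact: sI.
  by rewrite (ltW lq) (ltW qr).
have sL : (size L <= m)%N.
  apply: (alt_le l) => //; first by move=> x /subs/sI.
  exact: (subseq_sorted lt_trans sub ss).
have [E [sE uEQ EQI Es]] := extend_below (m - size L) II Io Il sI QI uQ.
have [|c cP] := prescribed_sign_changes II Fc Fn _ uEQ EQI.
  by rewrite size_cat sE sQ subnK.
have notin p : p \in s -> p \notin E ++ Q.
  move=> ps; rewrite mem_cat negb_or; apply/andP; split.
    by apply/negP => /Es/(_ _ ps); rewrite ltxx.
  by apply: contraL ps => /Qb[].
pose g x := \sum_i c i * F i x.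
(* The scalar [a] fixes the global sign by comparison at [l]; its power of -1 accounts for passing
   from the factors [p - q] to [q - p]. *)
pose a := g l * \prod_(q <- E ++ Q) (l - q) * (-1) ^+ size Q * f l.
have a0 : a != 0.
  have := cP _ _ Il Il (notin _ ls) (notin _ ls).
  rewrite -/(g l) /a => h; rewrite !mulf_neq0 ?signr_eq0//.
    by apply: contraTneq h => ->; rewrite !mul0r ltxx.
  by apply: contraTneq h => ->; rewrite mulr0 mul0r ltxx.
have gE b x : \sum_i (b * c i) * F i x = b * g x.
  by rewrite /g mulr_sumr; apply: eq_bigr => i _; rewrite mulrA.
exists (fun i => a * c i).
  apply: contrapT => h; move: (a0); rewrite /a [g l](_ : _ = 0) ?mul0r ?eqxx//.
  rewrite /g big1// => i _; have [->|ci] := eqVneq (c i) 0; first by rewrite mul0r.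
  exfalso; apply: h; exists i; rewrite mulf_neq0//.
move=> p ps; rewrite gE.
have := cP _ _ Il (sI _ ps) (notin _ ls) (notin _ ps); have := H _ ps.
rewrite -/(g l) -/(g p) [X in g p * X]big_cat /=.
have -> : \prod_(q <- Q) (p - q) = (-1) ^+ size Q * \prod_(q <- Q) (q - p).
  rewrite -mulrN1z; elim: (Q) => [|q Q' IH]; first by rewrite !big_nil mulr1.
  by rewrite !big_cons IH /= exprS; ring.
have : 0 < \prod_(e <- E) (p - e).
  by rewrite big_seq; apply: prodr_gt0 => e eE; rewrite subr_gt0 Es.
rewrite /a.
set PE := \prod_(e <- E) _; set PQ := \prod_(q <- Q) _.
set A := g l * _; set sg : R := (-1) ^+ _ => PE0 h1 h2.
move: (g p) PE PQ A sg PE0 h1 h2 => gp PE PQ A sg PE0 h1 h2.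
have PQ0 : PQ != 0.
  by apply: contraTneq h2 => ->; rewrite !mulr0 ltxx.
have := mulr_ge0 h1 (ltW h2).
(* The product of the two sign conditions is the desired quantity times the positive factor
   [PE * PQ ^+ 2]. *)
have -> : f l * f p * PQ * (A * (gp * (PE * (sg * PQ)))) =
  (PE * PQ ^+ 2) * (A * sg * f l * gp * f p) by ring.
by rewrite pmulr_rge0// mulr_gt0// exprn_even_gt0.
Qed.

(** * Passage to the whole interval by compactness *)

Lemma norm_neq0_exists {R : realType} {m : nat} (c : 'I_m -> R) :
  (exists j, c j != 0) <-> \row_j c j != 0.
Proof.
split=> [[j cj]|]; first by apply/eqP => /rowP/(_ j); rewrite !mxE; exact/eqP.
move=> c0; apply: contrapT => h; move/eqP: c0; apply; apply/rowP => j.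
rewrite !mxE; apply/eqP; apply: contrapT => /negP cj; apply: h; by exists j.
Qed.

Lemma cts_lincomb {R : realType} {T : topologicalType} {n : nat}
    (c : 'I_n -> R) (h : 'I_n -> T -> R) (t : T) :
  (forall i, {for t, continuous (h i)}) ->
  {for t, continuous (fun x => \sum_i c i * h i x)}.
Proof.
move=> hc; rewrite /prop_for /continuous_at.
apply: cvg_big => [|i _]; first exact: add_continuous.
by apply: cvgM; [exact: cvg_cst|exact: hc].
Qed.

(** Each point [x] imposes a closed condition [K x] on coefficients in the compact unit sphere [S].
    The finite case, after normalization, is the finite intersection property. *)
Lemma comparison_on_interval {R : realType} {m : nat} (I : set R)
    (F : 'I_m.+1 -> R -> R) (f : R -> R) :
  is_interval I -> open I ->
  (forall i x, I x -> {for x, continuous (F i)}) ->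
  (forall r, injective r -> (forall j, I (r j)) -> \det (colloc_mx F r) != 0) ->
  (forall l L, {in l :: L, forall x, I x} -> path <%R l L ->
     path (fun x y => f x * f y < 0) l L -> (size L <= m)%N) ->
  exists2 c : 'I_m.+1 -> R, exists j, c j != 0 &
    forall x, I x -> 0 <= (\sum_i c i * F i x) * f x.
Proof.
move=> II Io Fc Fn alt_le.
pose S := [set c : 'rV[R]_m.+1 | `|c| = 1].
pose K x := [set c : 'rV[R]_m.+1 | 0 <= (\sum_i c 0 i * F i x) * f x].
have cS : closed S.
  apply: (@closed_comp _ _ (fun c : 'rV[R]_m.+1 => `|c|) [set 1]).
    by move=> c _; exact: norm_continuous.
  exact: closed_eq.
have cK x : closed (K x).
  pose h (c : 'rV[R]_m.+1) := \sum_i (f x * F i x) * c 0 i.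
  rewrite (_ : K x = h @^-1` [set t | 0 <= t]).
    apply: closed_comp; last exact: closed_ge.
    by move=> c _; apply: cts_lincomb => i; exact: coord_continuous.
  have hE c : h c = (\sum_i c 0 i * F i x) * f x.
    by rewrite mulr_suml; apply: eq_bigr => i _; ring.
  by apply/seteqP; split=> c /=; rewrite hE.
have compS : compact S.
  apply: bounded_closed_compact => //; exists 1; split => // M M1 c /= ->.
  exact: ltW.
move: compS; rewrite compact_In0 => /(_ R I (fun x => S `&` K x)) [].
- by exists K.
- move=> D DI; have [||c c0 cP] := @comparison_on_finite R m I F f
      (sort <=%R (finmap.enum_fset D)) II Io Fc Fn alt_le.
  + by rewrite sort_lt_sorted finmap.fset_uniq.
  + by move=> x; rewrite mem_sort => /DI/set_mem.
  have n0 : `|\row_j c j| != 0 by rewrite normr_eq0; apply/norm_neq0_exists.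
  exists (`|\row_j c j|^-1 *: \row_j c j) => x /= xD; split.
    by rewrite /S /= normrZ normfV normr_id mulVf.
  rewrite /K /= (_ : \sum_i _ = `|\row_j c j|^-1 * \sum_i c i * F i x).
    by rewrite -mulrA mulr_ge0 ?invr_ge0// cP// mem_sort.
  by rewrite mulr_sumr; apply: eq_bigr => i _; rewrite !mxE mulrA.
move=> c cP.
(* That [c] has norm 1 is known only through a point of [I]; if [I] is empty, any nonzero
   coefficients do. *)
have [[x Ix]|I0] := pselect (exists x, I x); last first.
  exists (fun=> 1); first by exists ord0; rewrite oner_neq0.
  by move=> x Ix; exfalso; apply: I0; exists x.
exists (c 0) => [|y /cP[]//].
have [/= c1 _] := cP _ Ix.
apply/norm_neq0_exists; rewrite -normr_eq0 (_ : \row_j _ = c); last first.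
  by apply/rowP => j; rewrite mxE.
by rewrite c1 oner_neq0.
Qed.

(** * Sign changes on components of the zero set *)

Lemma cts_lt_ball {R : realType} (F : R -> R) (z a : R) :
  {for z, continuous F} -> F z < a ->
  exists2 d, 0 < d & forall t, `|z - t| < d -> F t < a.
Proof. by move=> Fc /(cvgr_lt _ Fc)/nbhs_ballP[d /= d0 dF]; exists d. Qed.

Lemma cts_gt_ball {R : realType} (F : R -> R) (z a : R) :
  {for z, continuous F} -> a < F z ->
  exists2 d, 0 < d & forall t, `|z - t| < d -> a < F t.
Proof. by move=> Fc /(cvgr_gt _ Fc)/nbhs_ballP[d /= d0 dF]; exists d. Qed.

(** [z] is the supremum of the points with negative value and [w] the infimum of the points from [z]
    on with positive value, so [F] vanishes between them. Two points are needed because the zeros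
    may fill a segment: negative values accumulate at [z], positive ones at [w]. *)
Lemma sign_change_segment {R : realType} (F : R -> R) (x y : R) :
  x < y -> {in `[x, y], continuous F} -> F x < 0 -> 0 < F y ->
  exists z w, [/\ x <= z, z <= w, w <= y, {in `[z, w], forall t, F t = 0} &
    forall d, 0 < d ->
      (exists t, [/\ t \in `[x, y], `|z - t| < d & F t < 0]) /\
      (exists t, [/\ t \in `[x, y], `|w - t| < d & 0 < F t])].
Proof.
move=> xy Fc Fx Fy.
have Fc' t : x <= t -> t <= y -> {for t, continuous F}.
  by move=> xt ty; apply: Fc; rewrite in_itv/= xt.
pose A := [set t | x <= t <= y /\ F t < 0].
have Ax : A x by split; rewrite // lexx ltW.
have Ay : ubound A y by move=> t [/andP[]].
have hA : has_sup A by split; [exists x|exists y].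
pose z := sup A.
have xz : x <= z by apply: ub_le_sup Ax; exists y.
have zy : z <= y by apply: ge_sup => //; exists x.
have Fge t : z < t -> t <= y -> 0 <= F t.
  move=> zt ty; rewrite leNgt; apply/negP => Ft.
  have : t <= z by apply: ub_le_sup; [exists y|split=> //; rewrite ty (le_trans xz (ltW zt))].
  by rewrite leNgt zt.
have nearz d : 0 < d -> exists t, [/\ x <= t, t <= z, z - d < t & F t < 0].
  move=> /sup_adherent/(_ hA)[t [/andP[xt ty] Ft] zt].
  by exists t; split => //; apply: ub_le_sup; [exists y|split => //; rewrite xt].
have Fz : F z = 0.
  apply/eqP; rewrite eq_le; apply/andP; split; rewrite leNgt; apply/negP => Fz.
    have [d d0 dF] := cts_gt_ball (Fc' _ xz zy) Fz.
    have [t [xt tz zt Ft]] := nearz _ d0.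
    have : 0 < F t by apply: dF; rewrite ger0_norm ?subr_ge0//; lra.
    by rewrite ltNge ltW.
  have [d d0 dF] := cts_lt_ball (Fc' _ xz zy) Fz.
  have zy' : z < y.
    by rewrite lt_neqAle zy andbT; apply: contraTneq Fy => <-; rewrite -leNgt ltW.
  (* A point to the right of [z], still in the segment and close enough to [z] for [F] to be
     negative there. *)
  pose t := Num.min y (z + d / 2).
  have zt : z < t by rewrite lt_min zy' ltrDl divr_gt0.
  have ty : t <= y by rewrite ge_min lexx.
  have td : t <= z + d / 2 by rewrite ge_min lexx orbT.
  have := Fge _ zt ty; rewrite leNgt dF// distrC ger0_norm ?subr_ge0 ?ltW//; lra.
pose B := [set t | z <= t <= y /\ 0 < F t].
have By : B y by split; rewrite // lexx zy.
have Bz : lbound B z by move=> t [/andP[]].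
have hB : has_inf B by split; [exists y|exists z].
pose w := inf B.
have zw : z <= w by apply: lb_le_inf => //; exists y.
have wy : w <= y by apply: ge_inf By; exists z.
have xw := le_trans xz zw.
have Fle t : z <= t -> t < w -> F t <= 0.
  move=> zt tw; rewrite leNgt; apply/negP => Ft.
  have : w <= t by apply: ge_inf; [exists z|split=> //; rewrite zt (le_trans (ltW tw) wy)].
  by rewrite leNgt tw.
have nearw d : 0 < d -> exists t, [/\ t <= y, w <= t, t < w + d & 0 < F t].
  move=> /inf_adherent/(_ hB)[t [/andP[zt ty] Ft] wt].
  by exists t; split => //; apply: ge_inf; [exists z|split => //; rewrite zt].
have Fw : F w = 0.
  apply/eqP; rewrite eq_le; apply/andP; split; rewrite leNgt; apply/negP => Fw.
    have [d d0 dF] := cts_gt_ball (Fc' _ xw wy) Fw.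
    have zw' : z < w.
      by rewrite lt_neqAle zw andbT; apply: contraTneq Fw => <-; rewrite Fz ltxx.
    pose t := Num.max z (w - d / 2).
    have tw : t < w by rewrite gt_max zw' gtrBl divr_gt0.
    have zt : z <= t by rewrite le_max lexx.
    have td : w - d / 2 <= t by rewrite le_max lexx orbT.
    have := Fle _ zt tw; rewrite leNgt dF// ger0_norm ?subr_ge0 ?ltW//; lra.
  have [d d0 dF] := cts_lt_ball (Fc' _ xw wy) Fw.
  have [t [ty wt tw Ft]] := nearw _ d0.
  have : F t < 0 by apply: dF; rewrite distrC ger0_norm ?subr_ge0//; lra.
  by rewrite ltNge ltW.
exists z, w; split => //.
  move=> t; rewrite in_itv/= => /andP[zt tw].
  have [->//|tz] := eqVneq t z; have [->//|tw'] := eqVneq t w.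
  apply/le_anti/andP; split; first by apply: Fle; rewrite // lt_neqAle tw' tw.
  by apply: Fge; [rewrite lt_neqAle eq_sym tz zt|exact: le_trans tw wy].
move=> d d0; split.
  have [t [xt tz zt Ft]] := nearz _ d0; exists t; split => //.
    by rewrite in_itv/= xt (le_trans tz).
  by rewrite ger0_norm ?subr_ge0//; lra.
have [t [ty wt tw Ft]] := nearw _ d0; exists t; split => //.
  by rewrite in_itv/= ty (le_trans xw).
by rewrite distrC ger0_norm ?subr_ge0//; lra.
Qed.

Lemma changes_sign_onN {R : realType} {T : topologicalType} (D : set T)
    (f : T -> R) (C : set T) :
  changes_sign_on D (fun x => - f x) C -> changes_sign_on D f C.
Proof.
move=> H U oU CU; have [y [z [Uy Uz fy fz]]] := H U oU CU.
by exists z, y; split; rewrite // -?oppr_gt0 // -oppr_lt0.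
Qed.

Lemma zero_setN {R : realType} {T : Type} (D : set T) (f : T -> R) :
  zero_set D (fun x => - f x) = zero_set D f.
Proof.
by apply/seteqP; split=> x [Dx /eqP fx]; split => //; apply/eqP; rewrite ?oppr_eq0// -oppr_eq0.
Qed.

(** The image of the segment between the two points [z] and [w] found on the line is connected and
    consists of zeros, so it lies in one component. A neighborhood of that component therefore
    reaches negative values near [phi z] and positive ones near [phi w]. *)
Lemma sign_change_between {R : realType} {T : topologicalType} (D : set T)
    (f : T -> R) (phi : R -> T) (x y : R) :
  x < y -> continuous phi -> {in `[x, y], forall t, D (phi t)} ->
  {in `[x, y], continuous (f \o phi)} -> f (phi x) * f (phi y) < 0 ->
  exists z, [/\ x < z, z < y, zero_set D f (phi z) &
    changes_sign_on D f (connected_component (zero_set D f) (phi z))].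
Proof.
move=> xy phic phiD fc fxy.
wlog [fx fy] : f fc fxy / f (phi x) < 0 /\ 0 < f (phi y).
  move=> H; have [fx|fx] : f (phi x) < 0 \/ 0 < f (phi x).
  - apply/orP; rewrite -neq_lt; apply: contraTneq fxy => ->.
    by rewrite mul0r ltxx.
  - by apply: H => //; split => //; rewrite -(nmulr_rlt0 _ fx).
  - have [| | |z [xz zy fz Hz]] := H (fun u => - f u).
    + by move=> t txy; apply: cvgN; exact: fc.
    + by rewrite mulrNN.
    + by split; rewrite ?oppr_lt0// oppr_gt0 -(pmulr_rlt0 _ fx).
    + move: fz Hz; rewrite zero_setN => fz Hz; exists z; split => //.
      exact: changes_sign_onN.
have [z [w [xz zw wy F0' H]]] := sign_change_segment xy fc fx fy.
have F0 t : t \in `[z, w] -> f (phi t) = 0 := F0' t.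
have sub t : t \in `[z, w] -> t \in `[x, y].
  by rewrite !in_itv/= => /andP[zt tw]; rewrite (le_trans xz zt) (le_trans tw wy).
have zin : z \in `[z, w] by rewrite in_itv/= lexx.
have win : w \in `[z, w] by rewrite in_itv/= lexx zw.
have Zz : zero_set D f (phi z) by split; [exact/phiD/sub|exact: F0].
exists z; split => //.
- by rewrite lt_neqAle xz andbT; apply: contraTneq fx => ->; rewrite (F0 _ zin) ltxx.
- rewrite lt_neqAle (le_trans zw wy) andbT.
  by apply: contraTneq fy => <-; rewrite (F0 _ zin) ltxx.
move=> U oU CU.
have Uz : U (phi z) by apply: CU; exact: connected_component_refl.
have Uw : U (phi w).
  apply: CU; have : (phi @` `[z, w]) (phi w) by exists w.
  apply: connected_component_max.
  - by exists z.
  - by move=> _ [t tzw <-]; split; [exact/phiD/sub|exact: F0].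
  - apply: connected_continuous_connected; first exact: segment_connected.
    exact: continuous_subspaceT.
have Uball s : U (phi s) -> exists2 d, 0 < d & forall t, `|s - t| < d -> U (phi t).
  move=> Us; have /nbhs_ballP[d /= d0 dU] := phic s _ (open_nbhs_nbhs (conj oU Us)).
  by exists d.
have [dz dz0 dzU] := Uball _ Uz; have [dw dw0 dwU] := Uball _ Uw.
have [[t [txy zt Ft]] _] := H _ dz0; have [_ [s [sxy ws Fs]]] := H _ dw0.
by exists (phi t), (phi s); split => //; split; auto.
Qed.

(* phi parametrizes (part of) D; the sign of h singles out the arc phi ]x, y[. *)
Lemma many_sign_changes {R : realType} {T : topologicalType} (D : set T)
    (f : T -> R) (I : set R) (phi : R -> T) :
  is_interval I -> continuous phi -> (forall t, I t -> D (phi t)) ->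
  (forall t, I t -> {for t, continuous (f \o phi)}) ->
  (forall x y, I x -> I y -> x < y -> exists h : T -> R, [/\ continuous h,
     forall t, I t -> (0 < h (phi t)) = (x < t < y) &
     forall d, D d -> h d = 0 -> d = phi x \/ d = phi y]) ->
  forall l L, {in l :: L, forall x, I x} -> path <%R l L ->
    path (fun x y => f (phi x) * f (phi y) < 0) l L ->
    `I_(size L) #<= sign_changes D f.
Proof.
move=> II phic phiD fc sep l L LI lL altL.
pose s i := nth 0 (l :: L) i.
have sI i : (i <= size L)%N -> I (s i).
  by move=> iL; apply: LI; rewrite mem_nth.
have slt i : (i < size L)%N -> s i < s i.+1 by move: i; apply/(pathP 0).
have salt i : (i < size L)%N -> f (phi (s i)) * f (phi (s i.+1)) < 0.
  by move: i; apply/(pathP 0 altL).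
have smono i j : (i <= j)%N -> (j <= size L)%N -> s i <= s j.
  move=> ij; rewrite -(subnKC ij); elim: (j - i)%N => [|k IH]; first by rewrite addn0.
  by rewrite addnS => kL; rewrite (le_trans (IH (ltnW kL)))// ltW// slt.
have zP i : exists z, (i < size L)%N -> [/\ s i < z, z < s i.+1, zero_set D f (phi z) &
    changes_sign_on D f (connected_component (zero_set D f) (phi z))].
  (* Beyond the last alternation the value 0 is a placeholder for the choice function. *)
  case: (ltnP i (size L)) => [iL|_]; last by exists 0.
  have sub t : t \in `[s i, s i.+1] -> I t.
    by rewrite in_itv/=; apply: II; apply: sI => //; exact: ltnW.
  have subD t : t \in `[s i, s i.+1] -> D (phi t) by move=> /sub/phiD.
  have subc : {in `[s i, s i.+1], continuous (f \o phi)} by move=> t /sub/fc.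
  by have [z Hz] := sign_change_between (slt _ iL) phic subD subc (salt _ iL); exists z.
have [z {}zP] := choice zP.
pose C i := connected_component (zero_set D f) (phi (z i)).
(* If two components coincided, [h] would be positive at one of their points and nonpositive at
   another, hence zero somewhere on the component. That forces an end of the arc to be a zero of
   [f], against the alternation. *)
have CP i j : (i < j)%N -> (j < size L)%N -> C i <> C j.
  move=> ij jL Cij; have iL := ltn_trans ij jL.
  have [siz zsi Zi _] := zP _ iL; have [sjz zsj Zj _] := zP _ jL.
  have Izi : I (z i) by apply: (II _ _ (sI _ (ltnW iL)) (sI _ iL)); rewrite !ltW.
  have Izj : I (z j) by apply: (II _ _ (sI _ (ltnW jL)) (sI _ jL)); rewrite !ltW.
  have [h [hc hpos h0]] := sep _ _ (sI _ (ltnW iL)) (sI _ iL) (slt _ iL).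
  have Ci : C i (phi (z i)) by exact: connected_component_refl.
  have Cj : C i (phi (z j)) by rewrite Cij; exact: connected_component_refl.
  have hzi : 0 < h (phi (z i)) by rewrite hpos// siz zsi.
  have hzj : h (phi (z j)) <= 0.
    rewrite leNgt hpos//; apply/negP => /andP[_].
    by rewrite ltNge (le_trans (smono _ _ ij (ltnW jL)))// ltW.
  have /connected_intervalP conn : connected (h @` C i).
    apply: connected_continuous_connected; first exact: component_connected.
    exact: continuous_subspaceT.
  have [d Cd hd] : (h @` C i) 0.
    by apply: (conn (h (phi (z j))) (h (phi (z i)))); [exists (phi (z j))|exists (phi (z i))|rewrite hzj ltW].
  have [Dd fd] := connected_component_sub Cd.
  have := salt _ iL.
  by have [<-|<-] := h0 _ Dd hd; rewrite fd ?mul0r ?mulr0 ltxx.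
have Cinj : {in `I_(size L) &, injective C}.
  move=> i j /set_mem/= iL /set_mem/= jL Cij.
  by case: (ltngtP i j) => // [/CP/(_ jL)|/CP/(_ iL)]; rewrite Cij.
have := inj_card_eq Cinj; rewrite card_eq_le => /andP[_ h].
apply: (card_le_trans h); apply: subset_card_le => _ [i /= iL <-].
have [_ _ Zi chi] := zP _ iL; split => //.
by exists (phi (z i)).
Qed.

(** * Orthogonality against a combination of the same sign *)

(** A nonnegative integrand with integral 0 vanishes almost everywhere. On []a, b[] it can vanish
    only at the finitely many zeros of the combination, so an interval of positive length would be
    negligible. *)
Lemma orthogonal_nonneg_absurd {R : realType} {n : nat} (E : set R)
    (w F : R -> R) (G : 'I_n -> R -> R) (c : 'I_n -> R) (a b : R) :
  measurable E -> (forall i, orthogonal_wrt E w F (G i)) ->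
  (forall x, E x -> 0 <= F x * (\sum_i c i * G i x) * w x) ->
  a < b -> `]a, b[%classic `<=` E -> (forall x, x \in `]a, b[ -> F x * w x != 0) ->
  finite_set [set x | (x \in `]a, b[) /\ \sum_i c i * G i x = 0] -> False.
Proof.
move=> mE orth pos ab abE Fw fin.
pose mu := @lebesgue_measure R.
pose u x := F x * (\sum_i c i * G i x) * w x.
have uE : (fun x => (u x)%:E) =
    (fun x => \sum_(i < n) ((c i)%:E * (F x * G i x * w x)%:E))%E.
  apply/funext => x; rewrite /u mulr_sumr mulr_suml -sumEFin.
  by apply: eq_bigr => i _; rewrite -EFinM; congr (_%:E); ring.
have int_i i : mu.-integrable E (fun x => ((c i)%:E * (F x * G i x * w x)%:E)%E).
  by apply: integrableZl => //; have [] := orth i.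
have intu : mu.-integrable E (fun x => (u x)%:E).
  by rewrite uE; apply: integrable_sum.
have u0 : (\int[mu]_(x in E) (u x)%:E = 0)%E.
  rewrite uE integral_sum// big1// => i _.
  by have [io i0] := orth i; rewrite integralZl// [X in (_ * X)%E]i0 mule0.
have : (\int[mu]_(x in E) `|(u x)%:E| = 0)%E.
  rewrite -u0; apply: eq_integral => x /set_mem Ex.
  by rewrite gee0_abs// lee_fin; exact: pos.
move/(ae_eq_integral_abs mu mE (measurable_int mu intu)) => nu.
have : mu.-negligible `]a, b[%classic.
  apply: negligibleS (negligibleU nu _).
    move=> x /= xab.
    have [gx|gx] := eqVneq (\sum_i c i * G i x) 0; last left.
      right; exact: (conj xab gx).
    move=> /(_ (abE _ xab)) [] /eqP; rewrite /u mulrAC mulf_eq0 (negbTE gx) orbF.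
    by apply/negP; exact: Fw.
  exists [set x | (x \in `]a, b[) /\ \sum_i c i * G i x = 0]; split => //.
    apply: countable_measurable => [t|]; first exact: measurable_set1.
    exact: finite_set_countable.
  exact/countable_lebesgue_measure0/finite_set_countable.
move=> neg; have : mu `]a, b[%classic = 0%E.
  apply: (@measure_negligible _ _ _ (@lebesgue_measure R)) neg.
  exact: measurable_itv.
have -> : mu `]a, b[%classic = (b - a)%:E.
  by rewrite /mu lebesgue_measure_itv /= lte_fin ab.
move/eqP.
by rewrite eqe subr_eq0 gt_eqF.
Qed.

(** A nonzero vector in the left kernel would be the coefficients of a combination vanishing at the
    [m.+1] distinct points [phi (r j)], one more than allowed. *)
Lemma chebyshev_det_neq0 {R : realType} {T : topologicalType} {m : nat}
    (D : set T) (fs : 'I_m.+1 -> T -> R) (I : set R) (phi : R -> T) :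
  chebyshev_system D fs -> (forall t, I t -> D (phi t)) ->
  {in I &, injective phi} ->
  forall r, injective r -> (forall j, I (r j)) ->
    \det (colloc_mx (fun i => fs i \o phi) r) != 0.
Proof.
move=> [_ cheb] phiD phiI r rI rin; apply/negP => /det0P[v v0 vM].
have [j vj] : exists j, v 0 j != 0.
  by apply/norm_neq0_exists; rewrite (_ : \row_j _ = v)//; apply/rowP => j; rewrite mxE.
have := cheb (fun j => v 0 j) (ex_intro _ j vj) => /= le_m.
pose g k := phi (r (@inord m k)).
have gI : {in `I_m.+1 &, injective g}.
  move=> k l /set_mem/= km /set_mem/= lm.
  move=> /(phiI _ _ (mem_set (rin _)) (mem_set (rin _))) /rI /(congr1 val) /=.
  by rewrite !inordK.
have := inj_card_eq gI; rewrite card_eq_le => /andP[_ h].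
suff : `I_m.+1 #<= `I_m by rewrite card_le_II ltnn.
apply: (card_le_trans h); apply: card_le_trans le_m.
apply: subset_card_le => _ [k /= km <-]; split; first exact: phiD.
move/rowP/(_ (inord k)) : vM; rewrite !mxE => vM; rewrite -[RHS]vM.
by apply: eq_bigr => i _; rewrite mxE.
Qed.

(** * The argument common to the interval and the circle *)

(** [phi] is the identity for an interval and the angular parametrization for the circle. The
    functions [h] are what makes the sign changes found along [I] lie on distinct components in
    [D]. *)
Lemma sign_changes_of_orthogonal {R : realType} {T : topologicalType} {m : nat}
    (D : set T) (I : set R) (phi : R -> T) (fs : 'I_m.+1 -> T -> R)
    (rho f : T -> R) :
  is_interval I -> open I -> continuous phi -> {in I &, injective phi} ->
  (forall t, I t -> D (phi t)) ->
  (forall x y, I x -> I y -> x < y -> exists h : T -> R, [/\ continuous h,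
     forall t, I t -> (0 < h (phi t)) = (x < t < y) &
     forall d, D d -> h d = 0 -> d = phi x \/ d = phi y]) ->
  chebyshev_system D fs ->
  (forall i t, I t -> {for t, continuous (fs i \o phi)}) ->
  (forall t, I t -> {for t, continuous (rho \o phi)}) ->
  (forall t, I t -> {for t, continuous (f \o phi)}) ->
  constant_sign D rho ->
  (forall i, orthogonal_wrt I (rho \o phi) (f \o phi) (fs i \o phi)) ->
  (exists2 x, I x & f (phi x) * rho (phi x) != 0) ->
  `I_m.+1 #<= sign_changes D f.
Proof.
move=> II Io phic phiI phiD sep cheb fsc rhoc fc [rho_sgn _] orth [x0 Ix0 x0N].
apply: contrapT => few.
have det0 := chebyshev_det_neq0 cheb phiD phiI.
have [|c [j cj] cP] := comparison_on_interval (f := f \o phi) II Io fsc det0.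
  move=> l L LI lL altL; rewrite leqNgt; apply/negP => mL; apply: few.
  apply: card_le_trans (many_sign_changes II phic phiD fc sep LI lL altL).
  by rewrite card_le_II.
(* The factor [e], equal to 1 or -1, absorbs the sign of [rho]. *)
have [e e0 eP] : exists2 e : R, e != 0 & forall x, I x ->
    0 <= (f \o phi) x * (\sum_i (e * c i) * (fs i \o phi) x) * (rho \o phi) x.
  have sumE e x : \sum_i (e * c i) * (fs i \o phi) x = e * (\sum_i c i * (fs i \o phi) x).
    by rewrite mulr_sumr; apply: eq_bigr => i _; rewrite mulrA.
  case: rho_sgn => rho_sgn; [exists 1|exists (-1)]; rewrite ?oppr_eq0 ?oner_neq0// => x Ix.
    rewrite sumE mul1r; apply: mulr_ge0; last exact/rho_sgn/phiD.
    by rewrite mulrC; exact: cP.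
  rewrite sumE mulN1r mulrN mulNr -mulrN; apply: mulr_ge0.
    by rewrite mulrC; exact: cP.
  by rewrite oppr_ge0; exact/rho_sgn/phiD.
have [d d0 dP] : exists2 d, 0 < d & forall t, `|x0 - t| < d ->
    I t /\ f (phi t) * rho (phi t) != 0.
  have /nbhs_ballP[d1 /= d10 d1P] := open_nbhs_nbhs (conj Io Ix0).
  have uc : {for x0, continuous (fun t => (f \o phi) t * (rho \o phi) t)}.
    by apply: cvgM; [exact: fc|exact: rhoc].
  have [d2 d20 d2P] : exists2 d, 0 < d & forall t, `|x0 - t| < d ->
      f (phi t) * rho (phi t) != 0.
    have : f (phi x0) * rho (phi x0) < 0 \/ 0 < f (phi x0) * rho (phi x0).
      by apply/orP; rewrite -neq_lt.
    case=> [/(cts_lt_ball uc)|/(cts_gt_ball uc)] [d d0 dP]; exists d => // t /dP /=.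
      by move=> h; rewrite lt_eqF.
    by move=> h; rewrite gt_eqF.
  exists (Num.min d1 d2) => [|t]; first by rewrite lt_min d10.
  by rewrite lt_min => /andP[/d1P ? /d2P].
have inball t : t \in `]x0 - d, x0 + d[ -> `|x0 - t| < d.
  by rewrite in_itv/= distrC ltr_distl.
apply: (@orthogonal_nonneg_absurd R m.+1 I _ _ _ (fun i => e * c i) (x0 - d) (x0 + d)
  (open_measurable Io) orth eP).
- by rewrite ltrBlDr -addrA ltrDl addr_gt0.
- by move=> t /inball/dP[].
- by move=> t /inball/dP[].
have sub : [set x | (x \in `]x0 - d, x0 + d[) /\
    \sum_i e * c i * (fs i \o phi) x = 0] `<=` I by move=> t [/inball/dP[]].
have phiI' : {in [set x | (x \in `]x0 - d, x0 + d[) /\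
    \sum_i e * c i * (fs i \o phi) x = 0] &, injective phi}.
  by move=> s t /set_mem/sub Is /set_mem/sub It; apply: phiI; exact: mem_set.
(* By injectivity of [phi], the zeros of the combination near [x0] inject into its zeros on [D],
   which number at most [m]. *)
apply/finite_set_leP; exists m.
have := inj_card_eq phiI'; rewrite card_eq_le => /andP[_ h].
apply: (card_le_trans h).
have := cheb.2 (fun i => e * c i) (ex_intro _ j (mulf_neq0 e0 cj)).
apply: card_le_trans; apply: subset_card_le => _ [t [tI t0] <-]; split => //.
by apply: phiD; apply: sub.
Qed.


(** * Open intervals with possibly infinite ends *)

Lemma open_interval_is_interval {R : realType} (a b : \bar R) :
  is_interval (open_interval a b).
Proof.
move=> x y [ax _] [_ yb] z /andP[xz zy]; split.
  by rewrite (lt_le_trans ax)// lee_fin.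
by rewrite (le_lt_trans _ yb)// lee_fin.
Qed.

Lemma open_interval_open {R : realType} (a b : \bar R) : open (open_interval a b).
Proof.
have oa : open [set x : R | (a < x%:E)%E].
  case: a => [r| |].
  - rewrite (_ : [set x | _] = [set x : R | r < x]); first exact: open_gt.
    by apply/seteqP; split=> x /=; rewrite lte_fin.
  - rewrite (_ : [set x | _] = set0); first exact: open0.
    by apply/seteqP; split=> x //=; rewrite ltNge leey.
  - rewrite (_ : [set x | _] = setT); first exact: openT.
    by apply/seteqP; split=> x //= _; rewrite ltNye.
have ob : open [set x : R | (x%:E < b)%E].
  case: b => [r| |].
  - rewrite (_ : [set x | _] = [set x : R | x < r]); first exact: open_lt.
    by apply/seteqP; split=> x /=; rewrite lte_fin.
  - rewrite (_ : [set x | _] = setT); first exact: openT.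
    by apply/seteqP; split=> x //= _; rewrite ltey.
  - rewrite (_ : [set x | _] = set0); first exact: open0.
    by apply/seteqP; split=> x //=; rewrite ltNge leNye.
exact: openI.
Qed.

Lemma card_le_I0 {T : Type} (A : set T) : `I_0 #<= A.
Proof. by rewrite II0; exact: card_ge0. Qed.

(** * Geometry of the circle and its parametrization *)

(** Cosine decreases on [[0, pi]]. For [s] beyond [pi], the reflected angle [pi *+ 2 - s] lies in
    that segment and exceeds [d], so the cosine is still below [cos d]. *)
Lemma cos_lt_cos {R : realType} (d s : R) :
  0 < d < pi -> 0 <= s < pi *+ 2 - d ->
  (cos d < cos s) = (s < d) /\ (cos s = cos d -> s = d).
Proof.
move=> /andP[d0 dpi] /andP[s0 sd].
have din : d \in `[0, pi] by rewrite in_itv/= !ltW.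
have [spi|spi] := leP s pi.
  have sin : s \in `[0, pi] by rewrite in_itv/= s0.
  by split; [rewrite ltr_cos|exact: cos_inj].
have cs : cos s = cos (pi *+ 2 - s) by rewrite -(cosN (_ - _)) opprB -[RHS]cosD2pi subrK.
have tin : pi *+ 2 - s \in `[0, pi] by rewrite in_itv/= mulr2n; apply/andP; split; lra.
have lt : cos s < cos d by rewrite cs ltr_cos//; lra.
split; last by move=> e; rewrite e ltxx in lt.
rewrite [LHS]lt_gtF//; apply/esym/lt_gtF; exact: lt_trans spi.
Qed.

(* The chord through the points of parameters x and y cuts the circle into two
   arcs, on which the equation of the chord has opposite signs. *)
Lemma chord_separates {R : realType} (x y : R) : 0 < x -> x < y -> y < pi *+ 2 ->
  exists h : R * R -> R, continuous h /\ forall t, 0 <= t <= pi *+ 2 ->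
    (0 < h (circle_param t)) = (x < t < y) /\
    (h (circle_param t) = 0 -> t = x \/ t = y).
Proof.
move=> x0 xy ypi.
(* [m] is the midpoint of the arc and [d] its half-length; at parameter [t] the chord equation
   becomes [cos (t - m) - cos d]. *)
pose m := (x + y) / 2; pose d := (y - x) / 2.
exists (fun p => p.1 * cos m + p.2 * sin m - cos d); split.
  move=> p; apply: cvgB; last exact: cvg_cst.
  apply: cvgD; apply: cvgM; try exact: cvg_cst.
    exact: cvg_fst.
  exact: cvg_snd.
move=> t /andP[t0 tpi]; rewrite /circle_param /=.
have -> : cos t * cos m + sin t * sin m = cos `|t - m| by rewrite cos_norm cosB.
rewrite mulr2n in ypi tpi.
have h1 : 0 < d < pi by apply/andP; split; rewrite /d; lra.
(* The two sides of the upper bound amount to [0 < x] and [y < pi *+ 2]. *)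
have h2 : 0 <= `|t - m| < pi *+ 2 - d.
  rewrite normr_ge0 ltr_norml mulr2n; apply/andP; split; rewrite /m /d; lra.
have [e1 e2] := cos_lt_cos h1 h2.
split.
  rewrite subr_gt0 e1 ltr_norml; apply/andP/andP; rewrite /m /d => -[u v]; split; lra.
move=> /subr0_eq/e2; rewrite /m /d.
have [tm|tm] := leP 0 (t - m).
  by rewrite ger0_norm// /m => e; right; lra.
by rewrite ltr0_norm// /m => e; left; lra.
Qed.

Lemma circle_param_continuous {R : realType} : continuous (@circle_param R).
Proof.
move=> t; apply: (@cvg_pair _ _ _ (nbhs t) (nbhs (cos t)) (nbhs (sin t))).
  exact: continuous_cos.
exact: continuous_sin.
Qed.

Lemma within_circle_continuous {R : realType} (f : R * R -> R) (t : R) :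
  {within @circle R, continuous f} -> 0 < t < pi *+ 2 ->
  {for t, continuous (f \o @circle_param R)}.
Proof.
move=> /subspace_continuousP fc /andP[t0 tpi] P /=.
have ct : circle (circle_param t).
  by exists t => //=; rewrite in_itv/= mulr_natl !ltW.
move=> /(fc _ ct) /= /(circle_param_continuous (x := t)) ntP.
have nt : nbhs t [set s | circle (circle_param s) -> P (f (circle_param s))] := ntP.
have nI : nbhs t `]0, pi *+ 2[%classic.
  by apply: open_nbhs_nbhs; split; [exact: interval_open|rewrite /= in_itv/= t0].
apply: (@filterS _ (nbhs t) _ _ _ _ (filterI nt nI)) => s; case=> h sI; apply: h.
exists s => //=; move: sI; rewrite !in_itv/= => /andP[s0 s1].
by rewrite mulr_natl !ltW.
Qed.

(** The endpoints have measure zero; they are restored one at a time. *)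
Lemma orthogonal_wrt_oo {R : realType} (a b : R) (w f g : R -> R) :
  orthogonal_wrt `[a, b] w f g -> orthogonal_wrt `]a, b[ w f g.
Proof.
move=> [io i0].
have sub1 : `]a, b]%classic `<=` `[a, b]%classic.
  by move=> x /=; rewrite !in_itv/= => /andP[/ltW -> ->].
have sub2 : `]a, b[%classic `<=` `[a, b]%classic.
  by move=> x /=; rewrite !in_itv/= => /andP[/ltW -> /ltW ->].
pose u x := (f x * g x * w x)%:E.
have io1 : (@lebesgue_measure R).-integrable `]a, b] u.
  by apply: (@integrableS _ _ _ (@lebesgue_measure R) `[a, b]%classic) => //; exact: measurable_itv.
have io2 : (@lebesgue_measure R).-integrable `]a, b[ u.
  by apply: (@integrableS _ _ _ (@lebesgue_measure R) `[a, b]%classic) => //; exact: measurable_itv.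
split => //; rewrite -[RHS]i0; transitivity (\int[@lebesgue_measure R]_(x in `]a, b]) u x)%E.
  by apply: integral_itv_bndo_bndc; exact: measurable_int io2.
by apply: integral_itv_obnd_cbnd; exact: measurable_int io1.
Qed.

(** * The two cases of the theorem *)

Lemma sign_changes_interval {R : realType} {m : nat} (a b : \bar R)
    (fs : 'I_m.+1 -> R -> R) (rho f : R -> R) :
  chebyshev_system (open_interval a b) fs ->
  {within open_interval a b, continuous rho} ->
  constant_sign (open_interval a b) rho ->
  {within open_interval a b, continuous f} ->
  (forall i, orthogonal_wrt (open_interval a b) rho f (fs i)) ->
  (exists2 x, open_interval a b x & f x * rho x != 0) ->
  `I_m.+1 #<= sign_changes (open_interval a b) f.
Proof.
move=> cheb rhoc sgn fc orth x0.
have Io := @open_interval_open R a b.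
have cts (g : R -> R) : {within open_interval a b, continuous g} ->
    forall t, open_interval a b t -> {for t, continuous g}.
  by rewrite continuous_open_subspace// => gc t It; apply: gc; exact: mem_set.
apply: (@sign_changes_of_orthogonal R R m _ (open_interval a b) idfun fs rho f) => //.
- exact: open_interval_is_interval.
- by move=> t; exact: cvg_id.
(* On the line a quadratic vanishing at [x] and [y] separates the inside from the outside. *)
- move=> x y Ix Iy xy; exists (fun t => (t - x) * (y - t)); split.
  + by move=> t; apply: cvgM; apply: cvgB; try exact: cvg_cst; exact: cvg_id.
  + move=> t _ /=; apply/idP/andP => [h|[xt ty]]; last by rewrite mulr_gt0 ?subr_gt0.
    by have [tx|tx] := leP t x; [split; nra|split; nra].
  + move=> d _ /eqP; rewrite mulf_eq0 !subr_eq0 => /orP[|] /eqP ->; first by left.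
    by right.
- by move=> i t It; apply: cts => //; exact: cheb.1.
- exact: cts.
- exact: cts.
Qed.

Lemma sign_changes_circle {R : realType} {m : nat}
    (fs : 'I_m.+1 -> R * R -> R) (rho f : R * R -> R) :
  chebyshev_system (@circle R) fs ->
  {within @circle R, continuous rho} ->
  constant_sign (@circle R) rho ->
  {within @circle R, continuous f} ->
  (forall i, circle_orthogonal_wrt rho f (fs i)) ->
  (exists2 z, circle z & f z * rho z != 0) ->
  `I_m.+1 #<= sign_changes (@circle R) f.
Proof.
move=> cheb rhoc sgn fc orth [z cz fz].
have pi2 : 0 < pi *+ 2 :> R by rewrite mulrn_wgt0 ?pi_gt0.
have IP (t : R) : `]0, pi *+ 2[%classic t -> 0 < t < pi *+ 2 by rewrite /= in_itv.
have IP' (t : R) : 0 < t < pi *+ 2 -> 0 <= t <= pi *+ 2.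
  by move=> /andP[/ltW -> /ltW ->].
apply: (@sign_changes_of_orthogonal R _ m (@circle R) `]0, pi *+ 2[%classic
  (@circle_param R) fs rho f) => //.
- exact: interval_is_interval.
- exact: circle_param_continuous.
(* Injectivity on the open parameter interval: the chord of parameters [x / 2] and [(x + y) / 2]
   cuts off an arc containing the point of [x] but not that of [y]. *)
- have lt_absurd (x y : R) : 0 < x -> x < y -> y < pi *+ 2 ->
      circle_param x <> circle_param y.
    move=> x0 xy y2 pxy.
    have [|||h [_ hP]] := @chord_separates R (x / 2) ((x + y) / 2); [lra|lra|lra|].
    have [|hx _] := hP x; first by rewrite !ltW// (lt_trans xy).
    have [|hy _] := hP y; first by rewrite !ltW// (lt_trans x0).
    have : (x / 2 < x < (x + y) / 2) = (x / 2 < y < (x + y) / 2) by rewrite -hx -hy pxy.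
    have -> : (x / 2 < x < (x + y) / 2) by apply/andP; split; lra.
    by move=> /esym/andP[_]; lra.
  move=> s t /set_mem/IP/andP[s0 s2] /set_mem/IP/andP[t0 t2] st.
  by case: (ltgtP s t) => // [|] /lt_absurd; [move=> /(_ s0 t2)|move=> /(_ t0 s2)]; rewrite st.
- by move=> t /IP/IP' tI; exists t => //=; rewrite in_itv/= mulr_natl.
- move=> x y /IP/andP[x0 x2] /IP/andP[y0 y2] xy.
  have [h [hc hP]] := chord_separates x0 xy y2; exists h; split => //.
    by move=> t /IP/IP'/hP[].
  move=> _ [t /= tI <-] ht; have tI' : 0 <= t <= pi *+ 2.
    by move: tI; rewrite in_itv/= mulr_natl.
  by have [_ /(_ ht)[->|->]] := hP _ tI'; [left|right].
- by move=> i t /IP; apply: within_circle_continuous; exact: cheb.1.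
- by move=> t /IP; exact: within_circle_continuous.
- by move=> t /IP; exact: within_circle_continuous.
- by move=> i; apply: orthogonal_wrt_oo; rewrite -mulr_natl; exact: orth.
(* The parameter [2 * pi] is replaced by 0, which leaves room to the right of [t]. *)
have [t t02 tz] : exists2 t : R, 0 <= t < pi *+ 2 & circle_param t = z.
  case: cz => t /=; rewrite in_itv/= mulr_natl => /andP[t0]; rewrite le_eqVlt.
  case/predU1P => [->|t2] tz; last by exists t; rewrite ?t0.
  by exists 0; rewrite ?lexx// -tz /circle_param cos0 sin0 cos2pi sin2pi.
have uc : f p * rho p @[p --> within (@circle R) (nbhs z)] --> f z * rho z.
  by apply: cvgM; [move/subspace_continuousP: fc; exact|move/subspace_continuousP: rhoc; exact].
have un : nbhs z [set p | circle p -> f p * rho p != 0].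
  by apply: (cvgr_neq0 _ uc fz); exact: within_filter.
rewrite -tz in un; have tP := circle_param_continuous un.
have /nbhs_ballP[d /= d0 dP] :
  nbhs t [set s | circle (circle_param s) -> f (circle_param s) * rho (circle_param s) != 0] := tP.
(* If [t] is 0 it is not in the open interval; [s] moves right of [t] by less than [d] and stays
   below [pi *+ 2], so that [f * rho] remains nonzero there. *)
pose s := Num.min (t + d / 2) ((t + (pi + pi)) / 2).
have /andP[t0 t2] := t02; rewrite mulr2n in pi2 t2.
have st : t < s by rewrite lt_min; apply/andP; split; lra.
have sd : s <= t + d / 2 by rewrite ge_min lexx.
have s2 : s <= (t + (pi + pi)) / 2 by rewrite ge_min lexx orbT.
have sI : 0 < s < pi *+ 2 by rewrite (mulr2n pi); apply/andP; split; lra.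
exists s; first by rewrite /= in_itv.
apply: dP; first by rewrite /ball/= distrC gtr0_norm ?subr_gt0//; lra.
by exists s => //=; rewrite in_itv/= mulr_natl; exact: IP'.
Qed.

Theorem theorem1 (R : realType) (n : nat) :
  (forall (a b : \bar R) (fs : 'I_n -> R -> R) (rho f : R -> R),
     (a < b)%E ->
     chebyshev_system (open_interval a b) fs ->
     {within open_interval a b, continuous rho} ->
     constant_sign (open_interval a b) rho ->
     {within open_interval a b, continuous f} ->
     (forall i, orthogonal_wrt (open_interval a b) rho f (fs i)) ->
     (exists2 x, open_interval a b x & f x * rho x != 0) ->
     `I_n #<= sign_changes (open_interval a b) f)
  /\
  (forall (fs : 'I_n -> R * R -> R) (rho f : R * R -> R),
     chebyshev_system (@circle R) fs ->
     {within @circle R, continuous rho} ->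
     constant_sign (@circle R) rho ->
     {within @circle R, continuous f} ->
     (forall i, circle_orthogonal_wrt rho f (fs i)) ->
     (exists2 z, circle z & f z * rho z != 0) ->
     `I_n #<= sign_changes (@circle R) f).
Proof.
(* For [n = 0] there is nothing to count; otherwise [n = m.+1], as the determinants require. *)
split; case: n => [|m].
- by move=> *; exact: card_le_I0.
- by move=> a b fs rho f _; exact: sign_changes_interval.
- by move=> *; exact: card_le_I0.
- by move=> fs rho f; exact: sign_changes_circle.
Qed.
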